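(* Let $H=(H,\Delta,\varepsilon,\Phi,\alpha,\beta,S)$ be a finite-dimensional quasi-Hopf algebra over a field $k$, and let $\Lambda$ be a two-sided integral of $H$. Then the elements $$q_R\Delta(\Lambda)p_R,\quad q_R\Delta(\Lambda)p_L,\quad q_L\Delta(\Lambda)p_R,\quad q_L\Delta(\Lambda)p_L$$ of $H\otimes H$ are invariant under gauge transformations; that is, for every gauge transformation $F$ on $H$ and all $A,B\in\{L,R\}$ one has $q_A^F\,\Delta_F(\Lambda)\,p_B^F=q_A\,\Delta(\Lambda)\,p_B$, where $q_A^F,p_B^F$ denote the elements $q_A,p_B$ formed from the quasi-Hopf algebra $H_F$. Moreover $$m(q_R\Delta(\Lambda)p_R)=m(q_R\Delta(\Lambda)p_L)=m(q_L\Delta(\Lambda)p_R)=m(q_L\Delta(\Lambda)p_L),$$ where $m$ denotes the multiplication of $H$, and the element $m(q_R\Delta(\Lambda)p_R)$ is central in $H$.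
   Context: A quasi-bialgebra over a field $k$ is $(H,\Delta,\varepsilon,\Phi)$ with $H$ a unital associative $k$-algebra, $\Delta:H\to H\otimes H$ and $\varepsilon:H\to k$ algebra maps, and $\Phi\in H\otimes H\otimes H$ invertible such that $(\varepsilon\otimes id)\Delta=id=(id\otimes\varepsilon)\Delta$; $\Phi(\Delta\otimes id)\Delta(h)\Phi^{-1}=(id\otimes\Delta)\Delta(h)$ for all $h$; $(id\otimes id\otimes\Delta)(\Phi)(\Delta\otimes id\otimes id)(\Phi)=(1\otimes\Phi)(id\otimes\Delta\otimes id)(\Phi)(\Phi\otimes1)$; $(id\otimes\varepsilon\otimes id)(\Phi)=1\otimes1$. Write $\Delta(h)=\sum h_1\otimes h_2$, $\Phi=\sum X_i\otimes Y_i\otimes Z_i$, $\Phi^{-1}=\sum\overline X_i\otimes\overline Y_i\otimes\overline Z_i$. A quasi-Hopf algebra $(H,\Delta,\varepsilon,\Phi,\alpha,\beta,S)$ is a quasi-bialgebra with an algebra anti-automorphism $S$ (the antipode) and $\alpha,\beta\in H$ such that for all $h\in H$: $\sum S(h_1)\alpha h_2=\varepsilon(h)\alpha$, $\sum h_1\beta S(h_2)=\varepsilon(h)\beta$, $\sum X_i\beta S(Y_i)\alpha Z_i=1$, $\sum S(\overline X_i)\alpha\overline Y_i\beta S(\overline Z_i)=1$. Define in $H\otimes H$: $q_R=\sum X_i\otimes S^{-1}(\alpha Z_i)Y_i$, $p_R=\sum\overline X_i\otimes\overline Y_i\beta S(\overline Z_i)$, $q_L=\sum S(\overline X_i)\alpha\overline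 Y_i\otimes\overline Z_i$, $p_L=\sum Y_iS^{-1}(X_i\beta)\otimes Z_i$. A gauge transformation on $H$ is an invertible $F=\sum f_i\otimes g_i\in H\otimes H$ with $(\varepsilon\otimes id)(F)=1=(id\otimes\varepsilon)(F)$. Write $F^{-1}=\sum d_i\otimes e_i$. Then $H_F=(H,\Delta_F,\varepsilon,\Phi_F,\alpha_F,\beta_F,S)$ is a quasi-Hopf algebra, where $\Delta_F(h)=F\Delta(h)F^{-1}$, $\Phi_F=(1\otimes F)(id\otimes\Delta)(F)\,\Phi\,(\Delta\otimes id)(F^{-1})(F^{-1}\otimes1)$, $\alpha_F=\sum S(d_i)\alpha e_i$, $\beta_F=\sum f_i\beta S(g_i)$. A left (right) integral of $H$ is $l\in H$ with $hl=\varepsilon(h)l$ (resp. $lh=\varepsilon(h)l$) for all $h\in H$; a two-sided integral is both. *)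

(* Defs.v *)
From HB Require Import structures.
From mathcomp Require Import all_boot all_order all_algebra all_field.

Set Implicit Arguments.
Unset Strict Implicit.
Unset Printing Implicit Defensive.

Import GRing.Theory.
Local Open Scope ring_scope.

Local Notation bilin := (bilinear_for *:%R *:%R).

(* The matrix t stands for \sum_(i, j) t i j *: (e_i \ox e_j), where e is the *)
(* chosen basis vbasis fullv of each factor.                                  *)
Definition tensor (k : fieldType) (U V : vectType k) : Type :=
  'M[k]_(\dim (fullv : {vspace U}), \dim (fullv : {vspace V})).

Reserved Notation "u \ox v" (at level 40, left associativity).
Notation "U \ox V" := (tensor U V) : type_scope.

HB.instance Definition _ (k : fieldType) (U V : vectType k) :=
  Vector.copy (U \ox V)%type
    'M[k]_(\dim (fullv : {vspace U}), \dim (fullv : {vspace V})).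

Definition tpure (k : fieldType) (U V : vectType k) (u : U) (v : V) :
    (U \ox V)%type :=
  \matrix_(i, j) (coord (vbasis fullv) i u * coord (vbasis fullv) j v).

Notation "u \ox v" := (tpure u v) : ring_scope.

(* For bilinear f, tlift f is the linear map U \ox V -> W with                *)
(* tlift f (u \ox v) = f u v; so for t = \sum_l u_l \ox v_l, tlift f t is     *)
(* \sum_l f u_l v_l. It is only meaningful for such f.                        *)
Definition tlift (k : fieldType) (U V W : vectType k) (f : U -> V -> W)
    (t : (U \ox V)%type) : W :=
  \sum_i \sum_j t i j *: f (vbasis fullv)`_i (vbasis fullv)`_j.

Definition tlift3 (k : fieldType) (U V W X : vectType k)
    (f : U -> V -> W -> X) (t : (U \ox V \ox W)%type) : X :=
  tlift (fun uv w => tlift (fun u v => f u v w) uv) t.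

Definition tmap (k : fieldType) (U V U' V' : vectType k)
    (f : U -> U') (g : V -> V') : (U \ox V)%type -> (U' \ox V')%type :=
  tlift (fun u v => f u \ox g v).

(* U \ox (V \ox W) -> (U \ox V) \ox W; \ox associates to the left. *)
Definition tassoc (k : fieldType) (U V W : vectType k) :
    (U \ox (V \ox W))%type -> (U \ox V \ox W)%type :=
  tlift (fun u => tlift (fun v w => u \ox v \ox w)).

Arguments tassoc {k U V W}.

Section TensorTheory.

Variables (k : fieldType) (U V W : vectType k).

Lemma tlift_is_linear (f : U -> V -> W) : linear (tlift f).
Proof.
move=> a s t; rewrite /tlift scaler_sumr -big_split; apply: eq_bigr => i _.
rewrite scaler_sumr -big_split; apply: eq_bigr => j _.
by rewrite !mxE scalerDl scalerA.
Qed.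

HB.instance Definition _ (f : U -> V -> W) :=
  GRing.isLinear.Build k (U \ox V)%type W *:%R (tlift f) (tlift_is_linear f).

Lemma tpure_bilin : bilin (@tpure k U V).
Proof.
split=> [v|u] a x y; apply/matrixP => i j; rewrite !mxE linearP.
  by rewrite mulrDl mulrA.
by rewrite mulrDr mulrCA.
Qed.

Lemma tlift_pure (f : U -> V -> W) u v : bilin f -> tlift f (u \ox v) = f u v.
Proof.
case=> fl fr.
pose fu (x : U) : {linear V -> W} :=
  HB.pack (f x) (GRing.isLinear.Build k V W *:%R (f x) (fr x)).
pose fv (y : V) : {linear U -> W} :=
  HB.pack (f^~ y) (GRing.isLinear.Build k U W *:%R (f^~ y) (fl y)).
rewrite {2}(coord_vbasis (memvf u)) -[f _ v]/(fv v _) linear_sum /tlift.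
apply: eq_bigr => i _; rewrite linearZ /= {2}(coord_vbasis (memvf v)).
rewrite -[f _ (\sum_i _)]/(fu _ _) linear_sum scaler_sumr.
by apply: eq_bigr => j _; rewrite linearZ /= scalerA mxE.
Qed.

Lemma tlift_id (t : (U \ox V)%type) : tlift (@tpure k U V) t = t.
Proof.
apply/matrixP => i j; rewrite /tlift summxE (bigD1 i) //= summxE (bigD1 j) //=.
have b X : free (vbasis (fullv : {vspace X})) by apply/basis_free/vbasisP.
rewrite !mxE !coord_free // !eqxx !mulr1 !big1 ?addr0 // => [i' ne|j' ne].
  rewrite summxE big1 // => j' _.
  by rewrite !mxE !coord_free // (negPf ne) mul0r mulr0.
by rewrite !mxE !coord_free // (negPf ne) !mulr0.
Qed.

Lemma tensor_ind (P : (U \ox V)%type -> Prop) :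
  (forall a s t, P s -> P t -> P (a *: s + t)) -> (forall u v, P (u \ox v)) ->
  forall t, P t.
Proof.
move=> PD Pp t; have P0: P 0.
  by have := PD (-1) _ _ (Pp 0 0) (Pp 0 0); rewrite scaleN1r addNr.
have PA s s' : P s -> P s' -> P (s + s').
  by move=> Ps Ps'; rewrite -[s]scale1r; apply: PD.
rewrite -[t]tlift_id /tlift; apply: (big_ind P) => // i _.
apply: (big_ind P) => // j _.
by rewrite -[_ *: _]addr0; apply: PD.
Qed.

End TensorTheory.

Section TensorMaps.

Variables (k : fieldType) (U V W U' V' : vectType k).

Lemma tmap_pure (f : {linear U -> U'}) (g : {linear V -> V'}) u v :
  tmap f g (u \ox v) = f u \ox g v.
Proof.
have [pl pr] := @tpure_bilin k U' V'.
by rewrite /tmap tlift_pure //; split=> x a y z; rewrite linearP ?pl ?pr.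
Qed.

Lemma tassoc_pure (u : U) (v : V) (w : W) :
  tassoc (u \ox (v \ox w)) = u \ox v \ox w.
Proof.
have [pl pr] := @tpure_bilin k U V.
have [ql qr] := @tpure_bilin k (U \ox V)%type W.
have Hb (u' : U) : bilin (fun (v : V) (w : W) => u' \ox v \ox w).
  by split=> x a y z; rewrite ?pr ?ql ?qr.
rewrite /tassoc tlift_pure ?tlift_pure //; split=> x a y z; last exact: linearP.
elim/tensor_ind: x => [b s t IHs IHt|v' w'].
  by rewrite !linearP /= IHs IHt !scalerDr !scalerA addrACA mulrC.
by rewrite /= !tlift_pure // pl ql.
Qed.

End TensorMaps.

Section TensorAlgebra.

Variables (k : fieldType) (A B : falgType k).
Local Notation T := (A \ox B)%type.

Definition tmul (s t : T) : T :=
  tlift (fun a b => tlift (fun c d => (a * c) \ox (b * d)) t) s.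

Fact tmul_bilin : bilin tmul.
Proof.
split=> [t|s] a x y; first exact: linearP.
have tmulE t : tmul s t = \sum_i \sum_j s i j *:
    tlift (fun c d => ((vbasis fullv)`_i * c) \ox ((vbasis fullv)`_j * d)) t.
  by [].
rewrite /= !tmulE scaler_sumr -big_split; apply: eq_bigr => i _ /=.
rewrite scaler_sumr -big_split; apply: eq_bigr => j _ /=.
by rewrite linearP scalerDr !scalerA mulrC.
Qed.

Fact tmul_pure a b c d : tmul (a \ox b) (c \ox d) = (a * c) \ox (b * d).
Proof.
have [pl pr] := @tpure_bilin k A B.
have Hr (a' : A) (b' : B) : bilin (fun c d => (a' * c) \ox (b' * d)).
  by split=> x e u v /=; rewrite mulrDr -scalerAr ?pl ?pr.
rewrite /tmul tlift_pure; first by rewrite tlift_pure.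
split=> y e u v; elim/tensor_ind: (c \ox d) => [f s t IHs IHt|c' d'].
- by rewrite !linearP /= IHs IHt !scalerDr !scalerA addrACA mulrC.
- by rewrite !tlift_pure //= mulrDl -scalerAl pl.
- by rewrite !linearP /= IHs IHt !scalerDr !scalerA addrACA mulrC.
- by rewrite !tlift_pure //= mulrDl -scalerAl pr.
Qed.

Fact tmulDl : left_distributive tmul +%R.
Proof. by move=> x y z; have:= tmul_bilin.1 z 1 x y; rewrite /= !scale1r. Qed.
Fact tmulDr : right_distributive tmul +%R.
Proof. by move=> x y z; have:= tmul_bilin.2 x 1 y z; rewrite /= !scale1r. Qed.
Fact tmul0l t : tmul 0 t = 0.
Proof. by apply: (addrI (tmul 0 t)); rewrite -tmulDl !addr0. Qed.
Fact tmul0r t : tmul t 0 = 0.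
Proof. by apply: (addrI (tmul t 0)); rewrite -tmulDr !addr0. Qed.
Fact tscaleAl a s t : a *: tmul s t = tmul (a *: s) t.
Proof.
by have:= tmul_bilin.1 t a s 0; rewrite /= !addr0 tmul0l addr0 => ->.
Qed.
Fact tscaleAr a s t : a *: tmul s t = tmul s (a *: t).
Proof.
by have:= tmul_bilin.2 s a t 0; rewrite /= !addr0 tmul0r addr0 => ->.
Qed.

Fact tmulA : associative tmul.
Proof.
move=> x y z; elim/tensor_ind: x => [a s t IHs IHt|a b].
  by rewrite !tmul_bilin.1 IHs IHt.
elim/tensor_ind: y => [e s t IHs IHt|c d].
  by rewrite !(tmul_bilin.1, tmul_bilin.2) IHs IHt.
elim/tensor_ind: z => [f s t IHs IHt|e f].
  by rewrite !tmul_bilin.2 IHs IHt.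
by rewrite !tmul_pure !mulrA.
Qed.

Fact tmul1l : left_id (1 \ox 1) tmul.
Proof.
move=> x; elim/tensor_ind: x => [a s t IHs IHt|a b].
  by rewrite tmul_bilin.2 IHs IHt.
by rewrite tmul_pure !mul1r.
Qed.

Fact tmul1r : right_id (1 \ox 1) tmul.
Proof.
move=> x; elim/tensor_ind: x => [a s t IHs IHt|a b].
  by rewrite tmul_bilin.1 IHs IHt.
by rewrite tmul_pure !mulr1.
Qed.

Fact tpure11_neq0 : 1 \ox 1 != 0 :> T.
Proof.
apply/eqP => /matrixP t0.
have nz (X : falgType k) : exists i, coord (vbasis fullv) i (1 : X) != 0.
  apply/existsP; rewrite -negb_forall; apply/negP => /forallP h0.
  have /eqP[] := oner_neq0 X; rewrite (coord_vbasis (memvf 1)).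
  by rewrite big1 // => i _; rewrite (eqP (h0 i)) scale0r.
have [[i ni] [j nj]] := (nz A, nz B).
by have /eqP := t0 i j; rewrite !mxE mulf_eq0 (negPf ni) (negPf nj).
Qed.

HB.instance Definition _ := GRing.Zmodule_isNzRing.Build T
  tmulA tmul1l tmul1r tmulDl tmulDr tpure11_neq0.
HB.instance Definition _ := GRing.Lmodule_isLalgebra.Build k T tscaleAl.
HB.instance Definition _ := GRing.Lalgebra_isAlgebra.Build k T tscaleAr.
HB.instance Definition _ := Algebra_isFalgebra.Build k T.

Lemma tpureM (a c : A) (b d : B) : (a \ox b) * (c \ox d) = (a * c) \ox (b * d).
Proof. exact: tmul_pure. Qed.

Lemma tpure1 : 1 \ox 1 = 1 :> T.
Proof. by []. Qed.

End TensorAlgebra.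

Section QuasiHopf.

Variables (k : fieldType) (H : falgType k).

Record qhopf_data := QHopfData {
  qh_Delta : {lrmorphism H -> (H \ox H)%type};
  qh_eps : {lrmorphism H -> k | *%R};
  qh_Phi : (H \ox H \ox H)%type;
  qh_alpha : H;
  qh_beta : H;
  qh_S : 'End(H)
}.

Implicit Types (Q : qhopf_data) (h l : H).

Local Notation "\Delta_ Q" := (qh_Delta Q) (at level 8, Q at level 0).
Local Notation "\eps_ Q" := (qh_eps Q) (at level 8, Q at level 0).
Local Notation "\Phi_ Q" := (qh_Phi Q) (at level 8, Q at level 0).
Local Notation "\alpha_ Q" := (qh_alpha Q) (at level 8, Q at level 0).
Local Notation "\beta_ Q" := (qh_beta Q) (at level 8, Q at level 0).
Local Notation "\S_ Q" := (qh_S Q) (at level 8, Q at level 0).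

(* All the equations between elements of triple and quadruple tensor powers   *)
(* are stated in the left-associated ones; tassoc performs the rebracketing.  *)
Record is_quasi_bialgebra Q : Prop := IsQuasiBialgebra {
  qb_counitl h : tlift (fun x y => \eps_Q x *: y) (\Delta_Q h) = h;
  qb_counitr h : tlift (fun x y => \eps_Q y *: x) (\Delta_Q h) = h;
  qb_Phi_unit : \Phi_Q \is a GRing.unit;
  qb_coassoc h :
    \Phi_Q * tmap \Delta_Q idfun (\Delta_Q h) * \Phi_Q^-1
    = tassoc (tmap idfun \Delta_Q (\Delta_Q h));
  qb_pentagon :
    tassoc (tmap idfun \Delta_Q \Phi_Q)
      * tmap (tmap \Delta_Q idfun) idfun \Phi_Q
    = tmap tassoc idfun (tassoc (1 \ox \Phi_Q))
      * tmap (tassoc \o tmap idfun \Delta_Q) idfun \Phi_Q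
      * (\Phi_Q \ox 1);
  qb_Phi_counit :
    tlift3 (fun x y z => \eps_Q y *: (x \ox z)) \Phi_Q = 1 \ox 1
}.

Record is_quasi_hopf Q : Prop := IsQuasiHopf {
  qh_quasi_bialgebra : is_quasi_bialgebra Q;
  qh_S1 : \S_Q 1 = 1;
  qh_SM x y : \S_Q (x * y) = \S_Q y * \S_Q x;
  qh_S_bij : bijective \S_Q;
  qh_antipodel h :
    tlift (fun x y => \S_Q x * \alpha_Q * y) (\Delta_Q h)
    = \eps_Q h *: \alpha_Q;
  qh_antipoder h :
    tlift (fun x y => x * \beta_Q * \S_Q y) (\Delta_Q h)
    = \eps_Q h *: \beta_Q;
  qh_antipode_Phi :
    tlift3 (fun x y z => x * \beta_Q * \S_Q y * \alpha_Q * z) \Phi_Q = 1;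
  qh_antipode_PhiV :
    tlift3 (fun x y z => \S_Q x * \alpha_Q * y * \beta_Q * \S_Q z) \Phi_Q^-1
    = 1
}.

(* qh_S is bijective, so its linear-function inverse (_^-1)%VF is two-sided. *)
Definition qR Q : (H \ox H)%type :=
  tlift3 (fun x y z => x \ox ((\S_Q)^-1%VF (\alpha_Q * z) * y)) \Phi_Q.

Definition pR Q : (H \ox H)%type :=
  tlift3 (fun x y z => x \ox (y * \beta_Q * \S_Q z)) \Phi_Q^-1.

Definition qL Q : (H \ox H)%type :=
  tlift3 (fun x y z => (\S_Q x * \alpha_Q * y) \ox z) \Phi_Q^-1.

Definition pL Q : (H \ox H)%type :=
  tlift3 (fun x y z => (y * (\S_Q)^-1%VF (x * \beta_Q)) \ox z) \Phi_Q.

Record gauge Q := Gauge {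
  gauge_val : (H \ox H)%type;
  gauge_unit : gauge_val \is a GRing.unit;
  gauge_counitl : tlift (fun x y => \eps_Q x *: y) gauge_val = 1;
  gauge_counitr : tlift (fun x y => \eps_Q y *: x) gauge_val = 1
}.

Definition twist_Delta Q (F : gauge Q) h : (H \ox H)%type :=
  gauge_val F * \Delta_Q h * (gauge_val F)^-1.

Fact twist_Delta_is_linear Q (F : gauge Q) : linear (twist_Delta F).
Proof.
by move=> a x y; rewrite /twist_Delta linearP mulrDr mulrDl -scalerAr -scalerAl.
Qed.

Fact twist_Delta_is_monoid_morphism Q (F : gauge Q) :
  monoid_morphism (twist_Delta F).
Proof.
have FU := gauge_unit F; rewrite /twist_Delta; split=> [|x y].
  by rewrite rmorph1 mulr1 divrr.
by rewrite rmorphM !mulrA mulrVK.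
Qed.

HB.instance Definition _ Q (F : gauge Q) :=
  GRing.isLinear.Build k H (H \ox H)%type *:%R (twist_Delta F)
    (twist_Delta_is_linear F).
HB.instance Definition _ Q (F : gauge Q) :=
  GRing.isMonoidMorphism.Build H (H \ox H)%type (twist_Delta F)
    (twist_Delta_is_monoid_morphism F).

Definition twist Q (F : gauge Q) : qhopf_data :=
  let f := gauge_val F in
  {| qh_Delta := twist_Delta F;
     qh_eps := \eps_Q;
     qh_Phi := tassoc (1 \ox f) * tassoc (tmap idfun \Delta_Q f) * \Phi_Q
       * tmap \Delta_Q idfun f^-1 * (f^-1 \ox 1);
     qh_alpha := tlift (fun x y => \S_Q x * \alpha_Q * y) f^-1;
     qh_beta := tlift (fun x y => x * \beta_Q * \S_Q y) f;
     qh_S := \S_Q |}.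

Definition left_integral Q l := forall h, h * l = \eps_Q h *: l.
Definition right_integral Q l := forall h, l * h = \eps_Q h *: l.
Definition two_sided_integral Q l := left_integral Q l /\ right_integral Q l.

Inductive side := sideL | sideR.

Definition qel (A : side) Q := if A is sideL then qL Q else qR Q.
Definition pel (B : side) Q := if B is sideL then pL Q else pR Q.

Definition mult : (H \ox H)%type -> H := tlift (fun x y => x * y).

End QuasiHopf.

(* Main.v *)
(* Write D = Delta(l). If l is a left integral, coassociativity and the       *)
(* antipode axioms give (1 \ox a) q_L D = (S(a) \ox 1) q_L D, and applying    *)
(* a \ox b \ox c \ox d |-> a beta S(b) alpha c \ox d to the pentagon gives    *)
(* (beta \ox 1) q_L D = D. Substituting this for D in q_R D and moving all    *)
(* second factors to the first ones turns q_R into X beta S(Y) alpha Z = 1,   *)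
(* so that q_R D = q_L D. Symmetrically D p_L = D p_R for a right integral;   *)
(* hence all four elements coincide, and the commutation rules of q_L D and   *)
(* D p_R show that S(a) commutes with their image under multiplication.       *)
(* For gauge invariance, F^-1 cancels alpha_F and beta_F, and the remaining   *)
(* occurrences of F are absorbed by D through the counit, which gives         *)
(* q_A^F F D = q_A D and D F^-1 p_B^F = D p_B.                                *)

Require Import Defs.
From HB Require Import structures.
From mathcomp Require Import all_boot all_order all_algebra all_field.

Import GRing.Theory.
Local Open Scope ring_scope.

(** The coproduct of an integral absorbs coproducts: [Delta h * Delta l] equals [eps h *: Delta l]
    for a left integral, and dually on the other side for a right one. Each of $q_L,q_R,p_L,p_R$ is
    a contraction of $\Phi^{\pm1}$. A coproduct multiplied on its outer side is collapsed by the
    antipode axiom for $\alpha$ or $\beta$ ([opqL_mapl] and its analogues); one multiplied on the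
    side facing $\Delta(l)$ is absorbed by the integral ([opqL_mapr] and its analogues). Either way
    only a counit survives.

    Applied to coassociativity, this gives the exchange rules [qL_left_integral] and
    [pR_right_integral]; applied to the pentagon, it gives [beta_qL] and [pR_alpha]. Together they
    yield [qR_eq_qL] and [pR_eq_pL], so the four elements agree already in $H\otimes H$, and the
    exchange rules give [mult_central]. Applied to $\Phi_F^{\pm1}$, the same principle strips off
    every occurrence of $F$ and gives [twist_invariant]. *)

Section Linearity.

Set Implicit Arguments.
Unset Strict Implicit.

(** * Linearity rules for tensor constructions *)

Variable k : fieldType.

Lemma tlift_linear (U V W : vectType k) (f : U -> V -> W) a s t :
  tlift f (a *: s + t) = a *: tlift f s + tlift f t.
Proof. exact: tlift_is_linear. Qed.

Lemma tlift3_linear (U V W X : vectType k) (f : U -> V -> W -> X) a s t :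
  tlift3 f (a *: s + t) = a *: tlift3 f s + tlift3 f t.
Proof. exact: tlift_is_linear. Qed.

Lemma tmap_linear (U V U' V' : vectType k) (f : U -> U') (g : V -> V') a s t :
  tmap f g (a *: s + t) = a *: tmap f g s + tmap f g t.
Proof. exact: tlift_is_linear. Qed.

Lemma tassoc_linear (U V W : vectType k) a (s t : (U \ox (V \ox W))%type) :
  tassoc (a *: s + t) = a *: tassoc s + tassoc t.
Proof. exact: tlift_is_linear. Qed.

Lemma tpure_linearl (U V : vectType k) (v : V) a (s t : U) :
  (a *: s + t) \ox v = a *: (s \ox v) + t \ox v.
Proof. exact: (@tpure_bilin k U V).1. Qed.

Lemma tpure_linearr (U V : vectType k) (u : U) a (s t : V) :
  u \ox (a *: s + t) = a *: (u \ox s) + u \ox t.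
Proof. exact: (@tpure_bilin k U V).2. Qed.

Lemma mul_linearl (A : algType k) a (s t u : A) :
  (a *: s + t) * u = a *: (s * u) + t * u.
Proof. by rewrite mulrDl scalerAl. Qed.

Lemma mul_linearr (A : algType k) a (s t u : A) :
  u * (a *: s + t) = a *: (u * s) + u * t.
Proof. by rewrite mulrDr scalerAr. Qed.

Lemma scale_linearl (V : lmodType k) a b c (v : V) :
  (a * b + c) *: v = a *: (b *: v) + c *: v.
Proof. by rewrite scalerDl scalerA. Qed.

Lemma scale_linearr (V : lmodType k) a b (u v : V) :
  b *: (a *: u + v) = a *: (b *: u) + b *: v.
Proof. by rewrite scalerDr !scalerA mulrC. Qed.

(** [tensor_ind] has [a *: s + t] as its inductive case; these rules pull that combination out of
    every construction, so the case closes with the induction hypotheses. *)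
Definition linE := (tlift_linear, tlift3_linear, tmap_linear, tassoc_linear,
  tpure_linearl, tpure_linearr, mul_linearl, mul_linearr, scale_linearl,
  scale_linearr, @linearP).

Lemma tpureZl (U V : vectType k) a (u : U) (v : V) :
  (a *: u) \ox v = a *: (u \ox v).
Proof.
have z0 : 0 \ox v = 0 :> (U \ox V)%type.
  by apply/matrixP => i j; rewrite !mxE linear0 mul0r.
by rewrite -[a *: u]addr0 tpure_linearl z0 addr0.
Qed.

Lemma tpureZr (U V : vectType k) a (u : U) (v : V) :
  u \ox (a *: v) = a *: (u \ox v).
Proof.
have z0 : u \ox 0 = 0 :> (U \ox V)%type.
  by apply/matrixP => i j; rewrite !mxE linear0 mulr0.
by rewrite -[a *: v]addr0 tpure_linearr z0 addr0.
Qed.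

Lemma tlift3_pure (U V W X : vectType k) (f : U -> V -> W -> X) u v w :
    (forall v w, linear (fun u => f u v w)) ->
    (forall u w, linear (fun v => f u v w)) ->
    (forall u v, linear (fun w => f u v w)) ->
  tlift3 f (u \ox v \ox w) = f u v w.
Proof.
move=> f1 f2 f3.
have lin t a w1 w2 : tlift (fun u v => f u v (a *: w1 + w2)) t =
    a *: tlift (fun u v => f u v w1) t + tlift (fun u v => f u v w2) t.
  elim/tensor_ind: t => [b s t IHs IHt|u' v'].
    by rewrite !linE IHs IHt !linE addrACA !scalerA mulrC.
  by rewrite !tlift_pure ?f3 //; split=> *; rewrite ?f1 ?f2.
rewrite /tlift3 !tlift_pure //; split=> [w' a s t|t a w1 w2]; last exact: lin.
by rewrite linE.
Qed.

End Linearity.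

(** * Algebra maps between tensor powers *)

Section TensorMorphisms.

Set Implicit Arguments.
Unset Strict Implicit.

Variable k : fieldType.

Lemma tmapM (A B A' B' : falgType k) (f : {lrmorphism A -> A'})
    (g : {lrmorphism B -> B'}) s t :
  tmap f g (s * t) = tmap f g s * tmap f g t.
Proof.
elim/tensor_ind: s => [a s1 s2 IH1 IH2|x y]; first by rewrite !linE IH1 IH2.
elim/tensor_ind: t => [a t1 t2 IH1 IH2|z w]; first by rewrite !linE IH1 IH2.
by rewrite tpureM !tmap_pure !rmorphM tpureM.
Qed.

Lemma tmap1 (A B A' B' : falgType k) (f : {lrmorphism A -> A'})
    (g : {lrmorphism B -> B'}) : tmap f g 1 = 1.
Proof. by rewrite -tpure1 tmap_pure !rmorph1. Qed.

HB.instance Definition _ (U V U' V' : vectType k) (f : U -> U') (g : V -> V') :=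
  GRing.isLinear.Build k (U \ox V)%type (U' \ox V')%type *:%R (tmap f g)
    (@tmap_linear k U V U' V' f g).

HB.instance Definition _ (A B A' B' : falgType k) (f : {lrmorphism A -> A'})
    (g : {lrmorphism B -> B'}) :=
  GRing.isMonoidMorphism.Build (A \ox B)%type (A' \ox B')%type (tmap f g)
    (tmap1 f g, tmapM f g).

Lemma tassocM (A B C : falgType k) (s t : (A \ox (B \ox C))%type) :
  tassoc (s * t) = tassoc s * tassoc t.
Proof.
elim/tensor_ind: s => [a s1 s2 IH1 IH2|x s]; first by rewrite !linE IH1 IH2.
elim/tensor_ind: s => [a s1 s2 IH1 IH2|y z]; first by rewrite !linE IH1 IH2.
elim/tensor_ind: t => [a t1 t2 IH1 IH2|u t]; first by rewrite !linE IH1 IH2.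
elim/tensor_ind: t => [a t1 t2 IH1 IH2|v w]; first by rewrite !linE IH1 IH2.
by rewrite !(tpureM, tassoc_pure).
Qed.

Lemma tassoc1 (A B C : falgType k) :
  tassoc (1 : (A \ox (B \ox C))%type) = 1.
Proof. by rewrite -!tpure1 tassoc_pure. Qed.

HB.instance Definition _ (U V W : vectType k) :=
  GRing.isLinear.Build k (U \ox (V \ox W))%type (U \ox V \ox W)%type *:%R
    (@tassoc k U V W) (@tassoc_linear k U V W).

HB.instance Definition _ (A B C : falgType k) :=
  GRing.isMonoidMorphism.Build (A \ox (B \ox C))%type (A \ox B \ox C)%type
    (@tassoc k A B C) (@tassoc1 A B C, @tassocM A B C).

End TensorMorphisms.

(** * Inverse antipode, counit maps and contractions *)

Section Contractions.

Set Implicit Arguments.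
Unset Strict Implicit.

Variables (k : fieldType) (H : falgType k) (Q : qhopf_data H).
Hypothesis hQ : is_quasi_hopf Q.

Local Notation Delta := (qh_Delta Q).
Local Notation eps := (qh_eps Q).
Local Notation S := (qh_S Q).
Local Notation "S^-1" := ((qh_S Q)^-1%VF).
Local Notation Phi := (qh_Phi Q).
Local Notation alpha := (qh_alpha Q).
Local Notation beta := (qh_beta Q).

Let qb : is_quasi_bialgebra Q := qh_quasi_bialgebra hQ.

Lemma antipodeK : cancel S S^-1.
Proof. exact/lker0_lfunK/lker0P/bij_inj/(qh_S_bij hQ). Qed.

Lemma antipodeVK : cancel S^-1 S.
Proof.
move=> x; have [T ST TS] := qh_S_bij hQ.
by rewrite -[in LHS](TS x) antipodeK TS.
Qed.

Lemma antipodeV1 : S^-1 1 = 1.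
Proof. by rewrite -[in LHS](qh_S1 hQ) antipodeK. Qed.

Lemma antipodeVM x y : S^-1 (x * y) = S^-1 y * S^-1 x.
Proof.
by rewrite -{1}[x]antipodeVK -{1}[y]antipodeVK -(qh_SM hQ) antipodeK.
Qed.

Definition counitl (V : vectType k) (t : (H \ox V)%type) : V :=
  tlift (fun x y => eps x *: y) t.

Definition counitr (U : vectType k) (t : (U \ox H)%type) : U :=
  tlift (fun x y => eps y *: x) t.

Definition contractl (a : H) (t : (H \ox H)%type) : H :=
  tlift (fun x y => S x * a * y) t.

Definition contractr (b : H) (t : (H \ox H)%type) : H :=
  tlift (fun x y => x * b * S y) t.

Lemma counitl_linear (V : vectType k) : linear (@counitl V).
Proof. exact: tlift_is_linear. Qed.

Lemma counitr_linear (U : vectType k) : linear (@counitr U).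
Proof. exact: tlift_is_linear. Qed.

Lemma contractl_linear a : linear (contractl a).
Proof. exact: tlift_is_linear. Qed.

Lemma contractr_linear b : linear (contractr b).
Proof. exact: tlift_is_linear. Qed.

Local Notation linE := (counitl_linear, counitr_linear, contractl_linear,
  contractr_linear, linE).

Lemma counitl_pure (V : vectType k) x (y : V) : counitl (x \ox y) = eps x *: y.
Proof.
by rewrite /counitl tlift_pure //; split=> ? ? ? ?; rewrite /= !linE.
Qed.

Lemma counitr_pure (U : vectType k) (x : U) y : counitr (x \ox y) = eps y *: x.
Proof.
by rewrite /counitr tlift_pure //; split=> ? ? ? ?; rewrite /= !linE.
Qed.

Lemma contractl_pure a x y : contractl a (x \ox y) = S x * a * y.
Proof.
by rewrite /contractl tlift_pure //; split=> ? ? ? ?; rewrite /= !linE.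
Qed.

Lemma contractr_pure b x y : contractr b (x \ox y) = x * b * S y.
Proof.
by rewrite /contractr tlift_pure //; split=> ? ? ? ?; rewrite /= !linE.
Qed.

Lemma counitl_is_monoid_morphism (B : falgType k) :
  monoid_morphism (@counitl B).
Proof.
split=> [|s t]; first by rewrite -tpure1 counitl_pure rmorph1 scale1r.
elim/tensor_ind: s => [a s1 s2 IH1 IH2|x y]; first by rewrite !linE IH1 IH2.
elim/tensor_ind: t => [a t1 t2 IH1 IH2|u v]; first by rewrite !linE IH1 IH2.
by rewrite tpureM !counitl_pure rmorphM -scalerAl -scalerAr scalerA.
Qed.

Lemma counitr_is_monoid_morphism (A : falgType k) :
  monoid_morphism (@counitr A).
Proof.
split=> [|s t]; first by rewrite -tpure1 counitr_pure rmorph1 scale1r.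
elim/tensor_ind: s => [a s1 s2 IH1 IH2|x y]; first by rewrite !linE IH1 IH2.
elim/tensor_ind: t => [a t1 t2 IH1 IH2|u v]; first by rewrite !linE IH1 IH2.
by rewrite tpureM !counitr_pure rmorphM -scalerAl -scalerAr scalerA.
Qed.

HB.instance Definition _ (V : vectType k) :=
  GRing.isLinear.Build k (H \ox V)%type V *:%R (@counitl V) (@counitl_linear V).
HB.instance Definition _ (U : vectType k) :=
  GRing.isLinear.Build k (U \ox H)%type U *:%R (@counitr U) (@counitr_linear U).
HB.instance Definition _ a :=
  GRing.isLinear.Build k (H \ox H)%type H *:%R (contractl a)
    (@contractl_linear a).
HB.instance Definition _ b :=
  GRing.isLinear.Build k (H \ox H)%type H *:%R (contractr b)
    (@contractr_linear b).
HB.instance Definition _ (B : falgType k) :=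
  GRing.isMonoidMorphism.Build (H \ox B)%type B (@counitl B)
    (@counitl_is_monoid_morphism B).
HB.instance Definition _ (A : falgType k) :=
  GRing.isMonoidMorphism.Build (A \ox H)%type A (@counitr A)
    (@counitr_is_monoid_morphism A).

Lemma counitl_Delta h : counitl (Delta h) = h.
Proof. exact: (qb_counitl qb). Qed.

Lemma counitr_Delta h : counitr (Delta h) = h.
Proof. exact: (qb_counitr qb). Qed.

Lemma contractl_Delta h : contractl alpha (Delta h) = eps h *: alpha.
Proof. exact: (qh_antipodel hQ). Qed.

Lemma contractr_Delta h : contractr beta (Delta h) = eps h *: beta.
Proof. exact: (qh_antipoder hQ). Qed.

Lemma contractl1 a : contractl a 1 = a.
Proof. by rewrite -tpure1 contractl_pure (qh_S1 hQ) mul1r mulr1. Qed.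

Lemma contractr1 b : contractr b 1 = b.
Proof. by rewrite -tpure1 contractr_pure (qh_S1 hQ) mul1r mulr1. Qed.

(** Since $S$ reverses products, $a\cdot(x\otimes y)=S(x)ay$ is a right action of $H\otimes H$ on
    $H$; [contractr] is likewise a left action. *)
Lemma contractlM a s t : contractl a (s * t) = contractl (contractl a s) t.
Proof.
elim/tensor_ind: t => [c t1 t2 IH1 IH2|u v]; first by rewrite !linE IH1 IH2.
rewrite contractl_pure.
elim/tensor_ind: s => [c s1 s2 IH1 IH2|x y]; first by rewrite !linE IH1 IH2.
by rewrite tpureM !contractl_pure (qh_SM hQ) !mulrA.
Qed.

Lemma contractrM b s t : contractr b (s * t) = contractr (contractr b t) s.
Proof.
elim/tensor_ind: s => [c s1 s2 IH1 IH2|x y]; first by rewrite !linE IH1 IH2.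
rewrite contractr_pure.
elim/tensor_ind: t => [c t1 t2 IH1 IH2|u v]; first by rewrite !linE IH1 IH2.
by rewrite tpureM !contractr_pure (qh_SM hQ) !mulrA.
Qed.

(* q_L = opqL alpha Phi^-1, q_R = opqR alpha Phi, p_L = oppL beta Phi and     *)
(* p_R = oppR beta Phi^-1; the parameters a and b are left free so that the   *)
(* elements of a twist of Q are covered as well.                              *)
Definition opqL a (M : (H \ox H \ox H)%type) : (H \ox H)%type :=
  tlift3 (fun x y z => (S x * a * y) \ox z) M.
Definition opqR a (M : (H \ox H \ox H)%type) : (H \ox H)%type :=
  tlift3 (fun x y z => x \ox (S^-1 (a * z) * y)) M.
Definition oppL b (M : (H \ox H \ox H)%type) : (H \ox H)%type :=
  tlift3 (fun x y z => (y * S^-1 (x * b)) \ox z) M.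
Definition oppR b (M : (H \ox H \ox H)%type) : (H \ox H)%type :=
  tlift3 (fun x y z => x \ox (y * b * S z)) M.

Lemma opqL_linear a : linear (opqL a).
Proof. exact: tlift3_linear. Qed.
Lemma opqR_linear a : linear (opqR a).
Proof. exact: tlift3_linear. Qed.
Lemma oppL_linear b : linear (oppL b).
Proof. exact: tlift3_linear. Qed.
Lemma oppR_linear b : linear (oppR b).
Proof. exact: tlift3_linear. Qed.

Local Notation linQ := (opqL_linear, opqR_linear, oppL_linear, oppR_linear,
  linE).

Lemma opqL_pure a x y z : opqL a (x \ox y \ox z) = (S x * a * y) \ox z.
Proof. by rewrite /opqL tlift3_pure // => ? ? ? ? ?; rewrite !linE. Qed.

Lemma opqR_pure a x y z : opqR a (x \ox y \ox z) = x \ox (S^-1 (a * z) * y).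
Proof. by rewrite /opqR tlift3_pure // => ? ? ? ? ?; rewrite !linE. Qed.

Lemma oppL_pure b x y z : oppL b (x \ox y \ox z) = (y * S^-1 (x * b)) \ox z.
Proof. by rewrite /oppL tlift3_pure // => ? ? ? ? ?; rewrite !linE. Qed.

Lemma oppR_pure b x y z : oppR b (x \ox y \ox z) = x \ox (y * b * S z).
Proof. by rewrite /oppR tlift3_pure // => ? ? ? ? ?; rewrite !linE. Qed.

(** * Factors multiplied onto the argument of a contraction *)

Lemma tensor3_ind (U V W : vectType k) (P : (U \ox V \ox W)%type -> Prop) :
    (forall a s t, P s -> P t -> P (a *: s + t)) ->
    (forall u v w, P (u \ox v \ox w)) ->
  forall t, P t.
Proof.
move=> PD Pp; elim/tensor_ind=> // t w.
elim/tensor_ind: t => [a s t Ps Pt|u v]; last exact: Pp.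
by rewrite linE; apply: PD.
Qed.

(** For $s=p\otimes q$ one has $S(px)\,a\,qy=S(x)\,(S(p)aq)\,y$, so $s$ acts on $a$ alone. The form
    [c *: a'] covers both $s=\Delta(u)$, where [c] is a counit, and a gauge transformation, where
    $\alpha_F$ becomes $\alpha$. *)
Lemma opqL_mull a a' c s v M : contractl a s = c *: a' ->
  opqL a ((s \ox v) * M) = c *: ((1 \ox v) * opqL a' M).
Proof.
move=> sa; elim/tensor3_ind: M => [d M N IHM IHN|x y z].
  by rewrite !linQ IHM IHN.
rewrite opqL_pure !tpureM mul1r -tpureZl scalerAl scalerAr -sa.
elim/tensor_ind: s {sa} => [d s t IHs IHt|p q].
  by rewrite !linQ IHs IHt.
by rewrite !tpureM opqL_pure contractl_pure (qh_SM hQ) !mulrA.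
Qed.

Lemma opqL_mulr a M u s :
  opqL a (M * tassoc (u \ox s)) = (S u \ox 1) * opqL a M * s.
Proof.
elim/tensor3_ind: M => [d M N IHM IHN|x y z]; first by rewrite !linQ IHM IHN.
elim/tensor_ind: s => [d s t IHs IHt|p q]; first by rewrite !linQ IHs IHt.
by rewrite tassoc_pure !tpureM !opqL_pure !tpureM (qh_SM hQ) mul1r !mulrA.
Qed.

(** Here $S^{-1}(w)\,p=S^{-1}(S(p)w)$ brings the factor $p$ of $s=p\otimes q$ next to $a$ under
    $S^{-1}$. *)
Lemma opqR_mull a a' c u s M : contractl a s = c *: a' ->
  opqR a (tassoc (u \ox s) * M) = c *: ((u \ox 1) * opqR a' M).
Proof.
move=> sa; elim/tensor3_ind: M => [d M N IHM IHN|x y z].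
  by rewrite !linQ IHM IHN.
rewrite opqR_pure !tpureM mul1r -tpureZr scalerAl -linearZ scalerAl -sa /=.
elim/tensor_ind: s {sa} => [d s t IHs IHt|p q].
  by rewrite !linQ IHs IHt.
rewrite tassoc_pure !tpureM opqR_pure contractl_pure -!mulrA !antipodeVM.
by rewrite antipodeK !mulrA.
Qed.

Lemma opqR_mulr a M s v :
  opqR a (M * (s \ox v)) = (1 \ox S^-1 v) * opqR a M * s.
Proof.
elim/tensor3_ind: M => [d M N IHM IHN|x y z]; first by rewrite !linQ IHM IHN.
elim/tensor_ind: s => [d s t IHs IHt|p q]; first by rewrite !linQ IHs IHt.
by rewrite !tpureM !opqR_pure !tpureM mul1r mulrA antipodeVM !mulrA.
Qed.

Lemma oppL_mulr b b' c s v M : contractr b s = c *: b' ->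
  oppL b (M * (s \ox v)) = c *: (oppL b' M * (1 \ox v)).
Proof.
move=> sb; elim/tensor3_ind: M => [d M N IHM IHN|x y z].
  by rewrite !linQ IHM IHN.
rewrite oppL_pure !tpureM mulr1 -tpureZl scalerAr -linearZ scalerAr -sb /=.
elim/tensor_ind: s {sb} => [d s t IHs IHt|p q].
  by rewrite !linQ IHs IHt.
rewrite !tpureM oppL_pure contractr_pure !mulrA !antipodeVM.
by rewrite antipodeK !mulrA.
Qed.

Lemma oppL_mull b M u s :
  oppL b (tassoc (u \ox s) * M) = s * oppL b M * (S^-1 u \ox 1).
Proof.
elim/tensor3_ind: M => [d M N IHM IHN|x y z]; first by rewrite !linQ IHM IHN.
elim/tensor_ind: s => [d s t IHs IHt|p q]; first by rewrite !linQ IHs IHt.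
rewrite tassoc_pure !tpureM !oppL_pure !tpureM mulr1 -[u * x * b]mulrA.
by rewrite antipodeVM !mulrA.
Qed.

Lemma oppR_mulr b b' c u s M : contractr b s = c *: b' ->
  oppR b (M * tassoc (u \ox s)) = c *: (oppR b' M * (u \ox 1)).
Proof.
move=> sb; elim/tensor3_ind: M => [d M N IHM IHN|x y z].
  by rewrite !linQ IHM IHN.
rewrite oppR_pure !tpureM mulr1 -tpureZr scalerAl scalerAr -sb.
elim/tensor_ind: s {sb} => [d s t IHs IHt|p q].
  by rewrite !linQ IHs IHt.
by rewrite tassoc_pure !tpureM oppR_pure contractr_pure (qh_SM hQ) !mulrA.
Qed.

Lemma oppR_mull b M s v :
  oppR b ((s \ox v) * M) = s * oppR b M * (1 \ox S v).
Proof.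
elim/tensor3_ind: M => [d M N IHM IHN|x y z]; first by rewrite !linQ IHM IHN.
elim/tensor_ind: s => [d s t IHs IHt|p q]; first by rewrite !linQ IHs IHt.
by rewrite !tpureM !oppR_pure !tpureM (qh_SM hQ) mulr1 !mulrA.
Qed.

(** The antipode axiom for $\alpha$ collapses each coproduct; this is [opqL_mull] with
    $s=\Delta(u)$. *)
Lemma opqL_mapl t M :
  opqL alpha (tmap Delta idfun t * M) = (1 \ox counitl t) * opqL alpha M.
Proof.
elim/tensor_ind: t => [a s t IHs IHt|u v]; first by rewrite !linQ IHs IHt.
rewrite tmap_pure (opqL_mull _ _ (contractl_Delta u)) counitl_pure.
by rewrite tpureZr -scalerAl.
Qed.

Lemma opqR_mapl t M :
  opqR alpha (tassoc (tmap idfun Delta t) * M)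
  = (counitr t \ox 1) * opqR alpha M.
Proof.
elim/tensor_ind: t => [a s t IHs IHt|u v]; first by rewrite !linQ IHs IHt.
rewrite tmap_pure (opqR_mull _ _ (contractl_Delta v)) counitr_pure.
by rewrite tpureZl -scalerAl.
Qed.

Lemma oppL_mapr t M :
  oppL beta (M * tmap Delta idfun t) = oppL beta M * (1 \ox counitl t).
Proof.
elim/tensor_ind: t => [a s t IHs IHt|u v]; first by rewrite !linQ IHs IHt.
rewrite tmap_pure (oppL_mulr _ _ (contractr_Delta u)) counitl_pure.
by rewrite tpureZr -scalerAr.
Qed.

Lemma oppR_mapr t M :
  oppR beta (M * tassoc (tmap idfun Delta t)) = oppR beta M * (counitr t \ox 1).
Proof.
elim/tensor_ind: t => [a s t IHs IHt|u v]; first by rewrite !linQ IHs IHt.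
rewrite tmap_pure (oppR_mulr _ _ (contractr_Delta v)) counitr_pure.
by rewrite tpureZl -scalerAr.
Qed.

(** * Absorption by the coproduct of an integral *)

Section LeftIntegral.

Variable l : H.
Hypothesis ll : left_integral Q l.

Lemma Delta_left_integral h : Delta h * Delta l = eps h *: Delta l.
Proof. by rewrite -rmorphM /= ll linearZ. Qed.

(** By [opqL_mulr] the factor $\Delta(v)$ leaves the contraction on the right, where it meets
    $\Delta(l)$ and becomes $\varepsilon(v)$. *)
Lemma opqL_mapr a M t :
  opqL a (M * tassoc (tmap idfun Delta t)) * Delta l
  = (S (counitr t) \ox 1) * opqL a M * Delta l.
Proof.
elim/tensor_ind: t => [c s t IHs IHt|u v]; first by rewrite !linQ IHs IHt.
rewrite tmap_pure opqL_mulr -!mulrA Delta_left_integral counitr_pure.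
by rewrite linearZ tpureZl -scalerAl -!scalerAr.
Qed.

Lemma opqR_mapr a M t :
  opqR a (M * tmap Delta idfun t) * Delta l
  = (1 \ox S^-1 (counitl t)) * opqR a M * Delta l.
Proof.
elim/tensor_ind: t => [c s t IHs IHt|u v]; first by rewrite !linQ IHs IHt.
rewrite tmap_pure opqR_mulr -!mulrA Delta_left_integral counitl_pure.
by rewrite linearZ tpureZr -scalerAl -!scalerAr.
Qed.

(** Both sides evaluate [opqL alpha] on $(\Delta\otimes
    id)\Delta(a)\,\Phi^{-1}=\Phi^{-1}(id\otimes\Delta)\Delta(a)$: the left form is collapsed by the
    antipode axiom, the right one is absorbed by $\Delta(l)$. *)
Lemma qL_left_integral a :
  (1 \ox a) * (qL Q * Delta l) = (S a \ox 1) * (qL Q * Delta l).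
Proof.
have := opqL_mapr alpha Phi^-1 (Delta a).
rewrite counitr_Delta -!mulrA => <-; rewrite mulrA.
have := opqL_mapl (Delta a) Phi^-1; rewrite counitl_Delta => <-.
by rewrite -(qb_coassoc qb) !mulrA mulVr ?mul1r // (qb_Phi_unit qb).
Qed.

End LeftIntegral.

Section RightIntegral.

Variable l : H.
Hypothesis rl : right_integral Q l.

Lemma Delta_right_integral h : Delta l * Delta h = eps h *: Delta l.
Proof. by rewrite -rmorphM /= rl linearZ. Qed.

Lemma oppL_mapl b M t :
  Delta l * oppL b (tassoc (tmap idfun Delta t) * M)
  = Delta l * oppL b M * (S^-1 (counitr t) \ox 1).
Proof.
elim/tensor_ind: t => [c s t IHs IHt|u v]; first by rewrite !linQ IHs IHt.
rewrite tmap_pure oppL_mull !mulrA Delta_right_integral counitr_pure.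
by rewrite linearZ tpureZl -!scalerAl -scalerAr.
Qed.

Lemma oppR_mapl b M t :
  Delta l * oppR b (tmap Delta idfun t * M)
  = Delta l * oppR b M * (1 \ox S (counitl t)).
Proof.
elim/tensor_ind: t => [c s t IHs IHt|u v]; first by rewrite !linQ IHs IHt.
rewrite tmap_pure oppR_mull !mulrA Delta_right_integral counitl_pure.
by rewrite linearZ tpureZr -!scalerAl -scalerAr.
Qed.

Lemma pR_right_integral a :
  Delta l * pR Q * (a \ox 1) = Delta l * pR Q * (1 \ox S a).
Proof.
have := oppR_mapl beta Phi^-1 (Delta a).
rewrite counitl_Delta => <-; rewrite -mulrA.
have := oppR_mapr (Delta a) Phi^-1; rewrite counitr_Delta => <-.
by rewrite -(qb_coassoc qb) !mulrA mulVr ?mul1r // (qb_Phi_unit qb).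
Qed.

End RightIntegral.

(* [X \ox Y \ox Z |-> X b S(Y) a Z], the contraction of Phi in the axiom      *)
(* [qh_antipode_Phi].                                                         *)
Definition contract3 b a (M : (H \ox H \ox H)%type) : H :=
  tlift3 (fun x y z => x * b * S y * a * z) M.

Lemma contract3_linear b a : linear (contract3 b a).
Proof. exact: tlift3_linear. Qed.

Lemma contract3_pure b a x y z :
  contract3 b a (x \ox y \ox z) = x * b * S y * a * z.
Proof. by rewrite /contract3 tlift3_pure // => ? ? ? ? ?; rewrite !linE. Qed.

(** For $s=p'\otimes q'$ and $t=p\otimes q$, the product contracts to
    $ux\,(pbS(q))\,S(y)\,(S(p')aq')\,zv$: $t$ acts on $b$ and $s$ on $a$. *)
Lemma contract3_mul b b' c a a' d u s t v M :
    contractr b t = c *: b' -> contractl a s = d *: a' ->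
  contract3 b a (tassoc (u \ox s) * M * (t \ox v))
  = c *: (d *: (u * contract3 b' a' M * v)).
Proof.
move=> tb sa; elim/tensor3_ind: M => [e M N IHM IHN|x y z].
  by rewrite !(contract3_linear, linE) IHM IHN.
transitivity (u * (x * contractr b t * S y * contractl a s * z) * v).
  elim/tensor_ind: t {tb} => [e t t' IHt IHt'|p q].
    by rewrite !(contract3_linear, linE) IHt IHt'.
  elim/tensor_ind: s {sa} => [e s s' IHs IHs'|p' q'].
    by rewrite !(contract3_linear, linE) IHs IHs'.
  rewrite tassoc_pure !tpureM contract3_pure contractl_pure contractr_pure.
  by rewrite !(qh_SM hQ) !mulrA.
rewrite tb sa contract3_pure.
by rewrite -!(scalerAl, scalerAr) scalerA mulrC -scalerA.
Qed.

Lemma contract3_Phi : contract3 beta alpha Phi = 1.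
Proof. exact: (qh_antipode_Phi hQ). Qed.

(** * The pentagon and the counits of $\Phi$ *)

Local Notation H3 := (H \ox H \ox H)%type.
Local Notation H4 := (H \ox H \ox H \ox H)%type.

Definition Delta1 (M : H3) : H4 := tmap (tmap Delta idfun) idfun M.
Definition Delta2 (M : H3) : H4 := tmap (tassoc \o tmap idfun Delta) idfun M.
Definition Delta3 (M : H3) : H4 := tassoc (tmap idfun Delta M).
Definition padl (M : H3) : H4 := tmap tassoc idfun (tassoc (1 \ox M)).

Lemma Delta1_linear : linear Delta1.
Proof. by move=> a M N; rewrite /Delta1 !linE. Qed.
Lemma Delta2_linear : linear Delta2.
Proof. by move=> a M N; rewrite /Delta2 !linE. Qed.
Lemma Delta3_linear : linear Delta3.
Proof. by move=> a M N; rewrite /Delta3 !linE. Qed.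
Lemma padl_linear : linear padl.
Proof. by move=> a M N; rewrite /padl !linE. Qed.

Lemma Delta1_pure x y z : Delta1 (x \ox y \ox z) = Delta x \ox y \ox z.
Proof. by rewrite /Delta1 tmap_pure /= tmap_pure. Qed.
Lemma Delta2_pure x y z :
  Delta2 (x \ox y \ox z) = tassoc (x \ox Delta y) \ox z.
Proof. by rewrite /Delta2 tmap_pure /= tmap_pure. Qed.
Lemma Delta3_pure t z : Delta3 (t \ox z) = tassoc (t \ox Delta z).
Proof. by rewrite /Delta3 tmap_pure. Qed.
Lemma padl_pure x y z : padl (x \ox y \ox z) = 1 \ox x \ox y \ox z.
Proof. by rewrite /padl tassoc_pure tmap_pure /= tassoc_pure. Qed.

Lemma Delta1_unit : Delta1 1 = 1. Proof. by rewrite /Delta1 rmorph1. Qed.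
Lemma Delta3_unit : Delta3 1 = 1. Proof. by rewrite /Delta3 !rmorph1. Qed.
Lemma padl_unit : padl 1 = 1. Proof. by rewrite -!tpure1 padl_pure. Qed.
Lemma Delta1M : {morph Delta1 : M N / M * N}.
Proof. by move=> M N; rewrite /Delta1 rmorphM. Qed.
Lemma Delta3M : {morph Delta3 : M N / M * N}.
Proof. by move=> M N; rewrite /Delta3 !rmorphM. Qed.
Lemma padlM : {morph padl : M N / M * N}.
Proof.
have lin := padl_linear => M N.
elim/tensor3_ind: M => [a M M' IH IH'|x y z];
  first by rewrite !(lin, linE) IH IH'.
elim/tensor3_ind: N => [a N N' IH IH'|u v w];
  first by rewrite !(lin, linE) IH IH'.
by rewrite !tpureM !padl_pure !tpureM mul1r.
Qed.

Lemma pentagon : Delta3 Phi * Delta1 Phi = padl Phi * Delta2 Phi * (Phi \ox 1).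
Proof. exact: (qb_pentagon qb). Qed.

(** With left-associated tensors, $id\otimes\varepsilon\otimes id$ is [counitr] on the first two
    legs and the identity on the third. *)
Lemma counit_middle_Phi : tmap (@counitr H) idfun Phi = 1.
Proof.
rewrite -[RHS](qb_Phi_counit qb).
elim/tensor3_ind: Phi => [a M N IHM IHN|x y z].
  by rewrite !linE IHM IHN.
rewrite tmap_pure /= counitr_pure tpureZl tlift3_pure // => ? ? ? ? ?;
by rewrite !linE.
Qed.

Lemma idempotent_unit (A : unitRingType) (x : A) :
  x \is a GRing.unit -> x * x = x -> x = 1.
Proof. by move=> xU xx; apply: (mulrI xU); rewrite mulr1. Qed.

Local Notation linD := (Delta1_linear, Delta2_linear, Delta3_linear,
  padl_linear, contract3_linear, linE).

Lemma tmap_counitl_tassoc x (s : (H \ox H)%type) :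
  tmap (@counitl H) idfun (tassoc (x \ox s)) = eps x *: s.
Proof.
elim/tensor_ind: s => [a s t IHs IHt|y z]; first by rewrite !linE IHs IHt.
by rewrite tassoc_pure tmap_pure /= counitl_pure tpureZl.
Qed.

Lemma counitr_tassoc (U : vectType k) (u : U) (s : (H \ox H)%type) :
  counitr (tassoc (u \ox s)) = u \ox counitr s.
Proof.
elim/tensor_ind: s => [a s t IHs IHt|y z]; first by rewrite !linE IHs IHt.
by rewrite tassoc_pure !counitr_pure tpureZr.
Qed.

(* Applying eps \ox eps to the first two factors of the pentagon gives        *)
(* E = E * E for the element E of the statement, which is invertible.         *)
Lemma counitl_Phi : tmap (@counitl H) idfun Phi = 1.
Proof.
apply: idempotent_unit; first exact: rmorph_unit (qb_Phi_unit qb).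
pose J (M : H4) : (H \ox H)%type :=
  tmap (@counitl H) idfun (tmap (tmap (@counitl H) idfun) idfun M).
have JM : {morph J : M N / M * N} by move=> M N; rewrite /J !rmorphM.
have Jlin : linear J by move=> a M N; rewrite /J !linE.
have Jpure (t : H3) z :
    J (t \ox z) = tmap (@counitl H) idfun (tmap (@counitl H) idfun t \ox z).
  by rewrite /J tmap_pure.
have J3 M : J (Delta3 M) = Delta (counitl (tmap (@counitr H) idfun M)).
  elim/tensor3_ind: M => [a M N IHM IHN|x y z].
    by rewrite !(Jlin, linD) IHM IHN.
  rewrite Delta3_pure tmap_pure /= counitr_pure counitl_pure !linearZ /=.
  rewrite -scalerA.
  elim/tensor_ind: (Delta z) => [a s t IHs IHt|p q].
    by rewrite !(Jlin, linD) IHs IHt.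
  rewrite tassoc_pure Jpure !tmap_pure /= !counitl_pure linearZ /= tpureZl.
  by rewrite scalerA mulrC.
have J1 M : J (Delta1 M) = tmap (@counitl H) idfun M.
  elim/tensor3_ind: M => [a M N IHM IHN|x y z].
    by rewrite !(Jlin, linD) IHM IHN.
  by rewrite Delta1_pure Jpure !tmap_pure /= counitl_Delta.
have JT M : J (padl M) = tmap (@counitl H) idfun M.
  elim/tensor3_ind: M => [a M N IHM IHN|x y z].
    by rewrite !(Jlin, linD) IHM IHN.
  rewrite padl_pure Jpure !tmap_pure /=.
  by rewrite (counitl_pure 1) rmorph1 scale1r.
have J2 M : J (Delta2 M) = tmap (@counitl H) idfun M.
  elim/tensor3_ind: M => [a M N IHM IHN|x y z].
    by rewrite !(Jlin, linD) IHM IHN.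
  rewrite Delta2_pure Jpure tmap_counitl_tassoc tpureZl linearZ /=.
  by rewrite !tmap_pure /= counitl_Delta counitl_pure tpureZl.
have J0 M : J (M \ox 1) = counitl (tmap (@counitr H) idfun M) \ox 1.
  elim/tensor3_ind: M => [a M N IHM IHN|x y z].
    by rewrite !(Jlin, linD) IHM IHN.
  rewrite Jpure !tmap_pure /= counitr_pure !counitl_pure !linearZ /=.
  by rewrite mulrC.
have := congr1 J pentagon.
rewrite !JM J3 J1 JT J2 J0 counit_middle_Phi !rmorph1 tpure1 mul1r mulr1.
by move=> <-.
Qed.

(* Same argument, with eps \ox eps applied to the last two factors.           *)
Lemma counitr_Phi : counitr Phi = 1.
Proof.
apply: idempotent_unit; first exact: rmorph_unit (qb_Phi_unit qb).
pose J (M : H4) : (H \ox H)%type :=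
  counitr (counitr M).
have JM : {morph J : M N / M * N} by move=> M N; rewrite /J !rmorphM.
have Jlin : linear J by move=> a M N; rewrite /J !linE.
have Jpure (t : H3) z : J (t \ox z) = eps z *: counitr t.
  by rewrite /J counitr_pure linearZ.
have J3 M : J (Delta3 M) = counitr M.
  elim/tensor_ind: M => [a M N IHM IHN|t z].
    by rewrite !(Jlin, linD) IHM IHN.
  by rewrite Delta3_pure /J counitr_tassoc counitr_Delta.
have J1 M : J (Delta1 M) = Delta (counitr (tmap (@counitr H) idfun M)).
  elim/tensor3_ind: M => [a M N IHM IHN|x y z].
    by rewrite !(Jlin, linD) IHM IHN.
  rewrite Delta1_pure tmap_pure Jpure /= !counitr_pure !linearZ /=.
  by rewrite !scalerA mulrC.
have JT M : J (padl M) = 1 \ox counitr (tmap (@counitr H) idfun M).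
  elim/tensor3_ind: M => [a M N IHM IHN|x y z].
    by rewrite !(Jlin, linD) IHM IHN.
  rewrite padl_pure tmap_pure Jpure /= !counitr_pure.
  by rewrite !tpureZr.
have J2 M : J (Delta2 M) = counitr M.
  elim/tensor3_ind: M => [a M N IHM IHN|x y z].
    by rewrite !(Jlin, linD) IHM IHN.
  rewrite Delta2_pure Jpure counitr_tassoc.
  by rewrite counitr_Delta counitr_pure.
have J0 M : J (M \ox 1) = counitr M by rewrite Jpure rmorph1 scale1r.
have := congr1 J pentagon.
rewrite !JM J3 J1 JT J2 J0 counit_middle_Phi !rmorph1 tpure1 mul1r mulr1.
by move=> <-.
Qed.

(** * Contracting the pentagon against an integral *)

Lemma Phi_contract_pL (M P : H3) l : left_integral Q l ->
  tlift (fun t d => contract3 beta alpha t \ox d) (padl M * Delta3 P) * Delta l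
  = (contractr beta (counitr P) \ox 1) * opqL alpha M * Delta l.
Proof.
move=> ll; pose psi (N : H4) : (H \ox H)%type :=
  tlift (fun t d => contract3 beta alpha t \ox d) N.
have psi_pure x y z w : psi (x \ox y \ox z \ox w)
    = (x * beta * S y * alpha * z) \ox w.
  rewrite /psi tlift_pure ?contract3_pure //.
  by split=> ? ? ? ?; rewrite /= !linD.
have psi_lin : linear psi by move=> a s t; rewrite /psi !linE.
rewrite -/(psi _); elim/tensor3_ind: M => [a M N IHM IHN|x y z].
  by rewrite !(psi_lin, linD, linQ) IHM IHN.
elim/tensor3_ind: P => [a M N IHM IHN|u v w].
  by rewrite !(psi_lin, linD, linQ) IHM IHN.
(* The contraction gives $u\beta S(xv)\alpha y w_1\otimes z w_2$, in which $S(xv)=S(v)S(x)$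
   separates $u\beta S(v)$ from the [opqL] term and leaves $\Delta(w)$ on the right, facing
   $\Delta(l)$. *)
transitivity ((contractr beta (u \ox v) \ox 1) *
  opqL alpha (x \ox y \ox z) * (Delta w * Delta l)).
  rewrite mulrA; congr (_ * _).
  rewrite padl_pure Delta3_pure.
  elim/tensor_ind: (Delta w) => [a s t IHs IHt|p q].
    by rewrite !(psi_lin, linD, linQ) IHs IHt.
  rewrite tassoc_pure !tpureM psi_pure contractr_pure opqL_pure !tpureM.
  by rewrite !mul1r (qh_SM hQ) !mulrA.
rewrite -[Delta w * _]rmorphM /= ll linearZ /= counitr_pure linearZ /=.
by rewrite tpureZl -!(scalerAl, scalerAr).
Qed.

(** The coproducts in [Delta2 P] and [Delta1 M] collapse around $\alpha$ and $\beta$ by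
    [contract3_mul], and what remains of $\Phi$ contracts to 1. *)
Lemma Phi_contract_counit (M P : H3) :
  tlift (fun t d => contract3 beta alpha t \ox d)
    (Delta2 P * (Phi \ox 1) * Delta1 M)
  = tmap (@counitr H) idfun P * tmap (@counitl H) idfun M.
Proof.
pose psi (N : H4) : (H \ox H)%type :=
  tlift (fun t d => contract3 beta alpha t \ox d) N.
have psi_pure t w : psi (t \ox w) = contract3 beta alpha t \ox w.
  rewrite /psi tlift_pure //.
  by split=> ? ? ? ?; rewrite /= !linD.
have psi_lin : linear psi by move=> a s t; rewrite /psi !linE.
rewrite -/(psi _); elim/tensor3_ind: M => [a M N IHM IHN|x y z].
  by rewrite !(psi_lin, linD, linQ) IHM IHN.
elim/tensor3_ind: P => [a M N IHM IHN|u v w].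
  by rewrite !(psi_lin, linD, linQ) IHM IHN.
rewrite Delta1_pure Delta2_pure !tmap_pure /= !tpureM psi_pure mulr1.
rewrite (contract3_mul _ _ _ (contractr_Delta x) (contractl_Delta v)).
rewrite contract3_Phi mulr1 counitr_pure counitl_pure.
by rewrite -scalerAl -scalerAr !tpureZl !scalerA mulrC.
Qed.

Lemma beta_qL l : left_integral Q l -> (beta \ox 1) * qL Q * Delta l = Delta l.
Proof.
move=> ll; have PU := qb_Phi_unit qb.
(* The pentagon is rearranged so that contracting the left side yields $q_L$ in front of
   $\Delta(l)$, while the right side reduces to counits of $\Phi^{\pm1}$, hence to 1. *)
have E : padl Phi^-1 * Delta3 Phi = Delta2 Phi * (Phi \ox 1) * Delta1 Phi^-1.
  have D1 : Delta1 Phi * Delta1 Phi^-1 = 1.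
    by rewrite -Delta1M divrr // Delta1_unit.
  have P1 : padl Phi^-1 * padl Phi = 1 by rewrite -padlM mulVr // padl_unit.
  rewrite -[LHS]mulr1 -D1 -(mulrA (padl _)) (mulrA (Delta3 _)) pentagon.
  by rewrite -!mulrA (mulrA (padl _)) P1 mul1r.
have := Phi_contract_pL Phi^-1 Phi ll.
rewrite E Phi_contract_counit counit_middle_Phi rmorphV //= counitl_Phi invr1.
by rewrite !mul1r counitr_Phi contractr1 => <-.
Qed.

(** Mirror of [Phi_contract_pL], with the contraction $a\otimes b\otimes c\otimes d\mapsto a\otimes
    b\beta S(c)\alpha d$; now $\Delta(l)$ absorbs the coproduct in [Delta1 P] from the left. *)
Lemma pR_contract_Phi (M P : H3) l : right_integral Q l ->
  Delta l * tlift3 (fun (s : (H \ox H)%type) c d =>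
    s * (1 \ox (beta * S c * alpha * d))) (Delta1 P * (M \ox 1))
  = Delta l * oppR beta M
    * (1 \ox contractl alpha (tmap (@counitl H) idfun P)).
Proof.
move=> rl; pose psi (N : H4) : (H \ox H)%type :=
  tlift3 (fun s c d => s * (1 \ox (beta * S c * alpha * d))) N.
have psi_pure s z w :
    psi (s \ox z \ox w) = s * (1 \ox (beta * S z * alpha * w)).
  by rewrite /psi tlift3_pure // => ? ? ? ? ?; rewrite !linE.
have psi_lin : linear psi by move=> a s t; rewrite /psi !linE.
rewrite -/(psi _); elim/tensor3_ind: M => [a M N IHM IHN|x y z].
  by rewrite !(psi_lin, linQ) IHM IHN.
elim/tensor3_ind: P => [a M N IHM IHN|u v w].
  by rewrite !(psi_lin, linD, linQ) IHM IHN.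
rewrite Delta1_pure !tpureM psi_pure mulr1 !mulrA Delta_right_integral //.
rewrite tmap_pure /= counitl_pure oppR_pure tpureZl linearZ /= contractl_pure.
rewrite tpureZr -!(scalerAl, scalerAr) -!mulrA !tpureM (qh_SM hQ) !mulr1.
by rewrite !mulrA.
Qed.

Lemma counit_contract_Phi (M P : H3) :
  tlift3 (fun (s : (H \ox H)%type) c d =>
    s * (1 \ox (beta * S c * alpha * d)))
    (Delta3 M * padl Phi * Delta2 P)
  = counitr M * tmap (@counitr H) idfun P.
Proof.
pose psi (N : H4) : (H \ox H)%type :=
  tlift3 (fun s c d => s * (1 \ox (beta * S c * alpha * d))) N.
have psi_pure s z w :
    psi (s \ox z \ox w) = s * (1 \ox (beta * S z * alpha * w)).
  by rewrite /psi tlift3_pure // => ? ? ? ? ?; rewrite !linE.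
have psi_lin : linear psi by move=> a s t; rewrite /psi !linE.
rewrite -/(psi _); elim/tensor3_ind: M => [a M N IHM IHN|x y z].
  by rewrite !(psi_lin, linD, linQ) IHM IHN.
elim/tensor3_ind: P => [a M N IHM IHN|u v w].
  by rewrite !(psi_lin, linD, linQ) IHM IHN.
have linT := (psi_lin, padl_linear, contract3_linear, @tassoc_linear k,
  @tpure_linearl k, @tpure_linearr k, @mul_linearl k, @mul_linearr k).
(* Arbitrary [s] and [t] replace $\Delta(z)$ and $\Delta(v)$, so that pure tensors suffice; the
   result isolates a [contract3] to which [contract3_mul] applies. *)
have E s t : psi (tassoc (x \ox y \ox s) * padl Phi * (tassoc (u \ox t) \ox w))
    = (x * u) \ox (y * contract3 beta alpha
        (tassoc (1 \ox s) * Phi * (t \ox 1)) * w).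
  elim/tensor3_ind: Phi => [a M N IHM IHN|p q r].
    by rewrite !linT IHM IHN.
  elim/tensor_ind: s => [a M N IHM IHN|s1 s2].
    by rewrite !linT IHM IHN.
  elim/tensor_ind: t => [a M N IHM IHN|t1 t2].
    by rewrite !linT IHM IHN.
  rewrite !tassoc_pure padl_pure !tpureM psi_pure tpureM contract3_pure.
  by rewrite !(mulr1, mul1r) (qh_SM hQ) !mulrA.
rewrite Delta2_pure Delta3_pure E.
rewrite (contract3_mul _ _ _ (contractr_Delta v) (contractl_Delta z)).
rewrite contract3_Phi !mulr1 tmap_pure /= !counitr_pure !tpureZl.
by rewrite -!(scalerAl, scalerAr) !tpureM mulr1 !tpureZr scalerA mulrC
  -scalerA.
Qed.

Lemma pR_alpha l : right_integral Q l ->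
  Delta l * pR Q * (1 \ox alpha) = Delta l.
Proof.
move=> rl; have PU := qb_Phi_unit qb.
have E : Delta1 Phi * (Phi^-1 \ox 1) = Delta3 Phi^-1 * padl Phi * Delta2 Phi.
  have D3 : Delta3 Phi^-1 * Delta3 Phi = 1.
    by rewrite -Delta3M mulVr // Delta3_unit.
  have P1 : (Phi \ox 1) * (Phi^-1 \ox 1) = 1 :> H4.
    by rewrite tpureM mulr1 divrr.
  rewrite -[LHS]mul1r -D3 -(mulrA (Delta3 _)) (mulrA (Delta3 Phi)) pentagon.
  by rewrite -!mulrA P1 mulr1.
have := pR_contract_Phi Phi^-1 Phi rl.
rewrite E counit_contract_Phi counit_middle_Phi rmorphV //= counitr_Phi invr1.
by rewrite !mulr1 counitl_Phi contractl1 => <-.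
Qed.

(** * Coincidence of the left and right elements *)

Lemma qR_eq_qL l : left_integral Q l -> qR Q * Delta l = qL Q * Delta l.
Proof.
move=> ll; rewrite -[in LHS](beta_qL ll) -(mulrA _ (qL Q)) mulrA.
rewrite -[RHS]mul1r; set T := qL Q * Delta l.
have TS a : (1 \ox a) * T = (S a \ox 1) * T by apply: qL_left_integral.
(* By [TS], the second factor $S^{-1}(\alpha z)y$ moves to the first as $S(y)\alpha z$, to the right
   of $x\beta$; for $M=\Phi$ the outcome is 1. *)
suff E M : opqR alpha M * (beta \ox 1) * T = (contract3 beta alpha M \ox 1) * T.
  by rewrite -tpure1 -{2}contract3_Phi -E.
elim/tensor3_ind: M => [a M N IHM IHN|x y z].
  by rewrite !(linD, linQ) IHM IHN.
rewrite opqR_pure contract3_pure tpureM mulr1.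
rewrite -[x * beta]mulr1 -[S^-1 _ * y]mul1r -tpureM -mulrA TS mulrA tpureM.
by rewrite !mulr1 (qh_SM hQ) antipodeVK !mulrA.
Qed.

Lemma pR_eq_pL l : right_integral Q l -> Delta l * pL Q = Delta l * pR Q.
Proof.
move=> rl; rewrite -[in LHS](pR_alpha rl) -mulrA.
set T := Delta l * pR Q; rewrite -[RHS]mulr1.
have TS a : T * (a \ox 1) = T * (1 \ox S a) by apply: pR_right_integral.
suff E M :
    T * ((1 \ox alpha) * oppL beta M) = T * (1 \ox contract3 beta alpha M).
  by rewrite -tpure1 -{3}contract3_Phi -E.
elim/tensor3_ind: M => [a M N IHM IHN|x y z].
  by rewrite !(linD, linQ) IHM IHN.
rewrite oppL_pure contract3_pure tpureM mul1r.
rewrite -[y * _]mulr1 -[alpha * z]mul1r -tpureM mulrA TS -mulrA tpureM.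
by rewrite !mulr1 (qh_SM hQ) antipodeVK !mulrA.
Qed.

(** * Invariance under gauge transformations *)

Section Gauge.

Variable F : gauge Q.

Local Notation f := (gauge_val F).
Local Notation QF := (twist F).

(** Stated for bare functions, so that it applies directly to maps such as $t\mapsto1\otimes t$ and
    $t\mapsto t\otimes1$. *)
Lemma invr_map (R R' : unitRingType) (g : R -> R') x :
    g 1 = 1 -> {morph g : y z / y * z} -> x \is a GRing.unit ->
  g x \is a GRing.unit /\ (g x)^-1 = g x^-1.
Proof.
move=> g1 gM xU.
have gxU : g x \is a GRing.unit.
  by apply/unitrP; exists (g x^-1); rewrite -!gM mulVr // mulrV.
by split=> //; apply: (mulrI gxU); rewrite -gM !divrr.
Qed.

Lemma twist_Phi_inv : (qh_Phi QF)^-1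
  = (f \ox 1) * tmap Delta idfun f * Phi^-1 * tassoc (tmap idfun Delta f^-1)
    * tassoc (1 \ox f^-1).
Proof.
have fU := gauge_unit F; have PU := qb_Phi_unit qb.
have fVU : f^-1 \is a GRing.unit by rewrite unitrV.
pose g1 (t : (H \ox H)%type) : H3 := tassoc (1 \ox t).
pose g2 (t : (H \ox H)%type) : H3 := tassoc (tmap idfun Delta t).
pose g3 (t : (H \ox H)%type) : H3 := tmap Delta idfun t.
pose g4 (t : (H \ox H)%type) : H3 := t \ox 1.
have [|s t|U1 V1] := @invr_map _ _ g1 f _ _ fU.
- by rewrite /g1 tpure1 rmorph1.
- by rewrite /g1 -rmorphM tpureM mulr1.
have [|s t|U2 V2] := @invr_map _ _ g2 f _ _ fU.
- by rewrite /g2 !rmorph1.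
- by rewrite /g2 !rmorphM.
have [|s t|U3 V3] := @invr_map _ _ g3 f^-1 _ _ fVU.
- by rewrite /g3 rmorph1.
- by rewrite /g3 rmorphM.
have [|s t|U4 V4] := @invr_map _ _ g4 f^-1 _ _ fVU.
- by rewrite /g4 tpure1.
- by rewrite /g4 tpureM mulr1.
have -> : qh_Phi QF = g1 f * g2 f * Phi * g3 f^-1 * g4 f^-1 by [].
by rewrite !invrM ?unitrMl ?unitrMr // V1 V2 V3 V4 !invrK !mulrA.
Qed.

Lemma counitl_gauge : counitl f = 1.
Proof. exact: gauge_counitl. Qed.

Lemma counitr_gauge : counitr f = 1.
Proof. exact: gauge_counitr. Qed.

Lemma counitl_gaugeV : counitl f^-1 = 1.
Proof. by rewrite rmorphV ?gauge_unit //= counitl_gauge invr1. Qed.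

Lemma counitr_gaugeV : counitr f^-1 = 1.
Proof. by rewrite rmorphV ?gauge_unit //= counitr_gauge invr1. Qed.

(** $\alpha_F$ is $\alpha$ acted on by $F^{-1}$, so acting by $F$ undoes it. The scalar 1 fits the
    hypothesis of [opqL_mull] and [opqR_mull]. *)
Lemma contractl_gauge : contractl (qh_alpha QF) f = 1 *: alpha.
Proof. by rewrite -contractlM mulVr ?gauge_unit // contractl1 scale1r. Qed.

Lemma contractr_gaugeV : contractr (qh_beta QF) f^-1 = 1 *: beta.
Proof. by rewrite -contractrM mulVr ?gauge_unit // contractr1 scale1r. Qed.

(** In $\Phi_F^{-1}$, the outer $F\otimes1$ turns $\alpha_F$ into $\alpha$, $(\Delta\otimes id)(F)$
    collapses, $1\otimes F^{-1}$ comes out on the right and cancels [f], and $\Delta(l)$ absorbs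
    $(id\otimes\Delta)(F^{-1})$. *)
Lemma twist_qL l : left_integral Q l -> qL QF * f * Delta l = qL Q * Delta l.
Proof.
move=> ll; have fU := gauge_unit F.
have -> : qL QF = opqL (qh_alpha QF) (qh_Phi QF)^-1 by [].
rewrite twist_Phi_inv opqL_mulr -!mulrA (opqL_mull _ _ contractl_gauge).
rewrite scale1r opqL_mapl counitl_gauge (qh_S1 hQ) tpure1 !mul1r mulKr //.
by rewrite opqL_mapr // counitr_gaugeV (qh_S1 hQ) mul1r.
Qed.

Lemma twist_qR l : left_integral Q l -> qR QF * f * Delta l = qR Q * Delta l.
Proof.
move=> ll; have fU := gauge_unit F.
have -> : qR QF = opqR (qh_alpha QF) (qh_Phi QF) by [].
rewrite opqR_mulr -!mulrA (opqR_mull _ _ contractl_gauge).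
rewrite scale1r opqR_mapl counitr_gauge antipodeV1 tpure1 !mul1r mulKr //.
by rewrite opqR_mapr // counitl_gaugeV antipodeV1 mul1r.
Qed.

(** Mirror argument: $F^{-1}\otimes1$ turns $\beta_F$ into $\beta$, and the factor $1\otimes F$
    leaves on the left to cancel $F^{-1}$. *)
Lemma twist_pL l :
  right_integral Q l -> Delta l * (f^-1 * pL QF) = Delta l * pL Q.
Proof.
move=> rl; have fU := gauge_unit F.
have -> : pL QF = oppL (qh_beta QF) (qh_Phi QF) by [].
rewrite (oppL_mulr _ _ contractr_gaugeV) scale1r oppL_mapr counitl_gaugeV.
rewrite tpure1 !mulr1 -mulrA oppL_mull antipodeV1 tpure1 mulr1 mulKr //.
by rewrite oppL_mapl // counitr_gauge antipodeV1 mulr1.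
Qed.

Lemma twist_pR l :
  right_integral Q l -> Delta l * (f^-1 * pR QF) = Delta l * pR Q.
Proof.
move=> rl; have fU := gauge_unit F.
have -> : pR QF = oppR (qh_beta QF) (qh_Phi QF)^-1 by [].
rewrite twist_Phi_inv (oppR_mulr _ _ contractr_gaugeV) scale1r oppR_mapr.
rewrite counitr_gaugeV tpure1 !mulr1 -mulrA oppR_mull (qh_S1 hQ) tpure1 mulr1.
by rewrite mulKr // oppR_mapl // counitl_gauge (qh_S1 hQ) mulr1.
Qed.

Lemma twist_invariant l A B : two_sided_integral Q l ->
  qel A QF * qh_Delta QF l * pel B QF = qel A Q * Delta l * pel B Q.
Proof.
move=> [ll rl]; rewrite -[qh_Delta QF l]/(f * Delta l * f^-1).
have qA : qel A QF * f * Delta l = qel A Q * Delta l.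
  by case: A; rewrite /= ?twist_qL ?twist_qR.
have pB : Delta l * (f^-1 * pel B QF) = Delta l * pel B Q.
  by case: B; rewrite /= ?twist_pL ?twist_pR.
by rewrite !mulrA qA -2![LHS]mulrA pB !mulrA.
Qed.

End Gauge.

(** * Multiplication and centrality *)

Lemma mult_linear : linear (@mult k H).
Proof. exact: tlift_linear. Qed.

Lemma mult_pure x y : mult (x \ox y) = x * y :> H.
Proof. by rewrite /mult tlift_pure //; split=> ? ? ? ?; rewrite /= !linE. Qed.

Lemma mult_outer a b (t : (H \ox H)%type) :
  mult ((a \ox 1) * t * (1 \ox b)) = a * mult t * b.
Proof.
elim/tensor_ind: t => [c s t IHs IHt|x y].
  by rewrite !(mult_linear, linE) IHs IHt.
by rewrite !tpureM !mult_pure mul1r mulr1 !mulrA.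
Qed.

Lemma mult_inner a (t : (H \ox H)%type) :
  mult ((1 \ox a) * t) = mult (t * (a \ox 1)).
Proof.
elim/tensor_ind: t => [c s t IHs IHt|x y].
  by rewrite !(mult_linear, linE) IHs IHt.
by rewrite !tpureM !mult_pure mul1r mulr1 !mulrA.
Qed.

(** With $t=q_R\Delta(l)p_R$, the exchange rules turn the identity $m((1\otimes
    a)t)=m(t(a\otimes1))$ into $S(a)m(t)=m(t)S(a)$. *)
Lemma mult_central l : two_sided_integral Q l ->
  mult (qR Q * Delta l * pR Q) \in 'Z({:H})%VS.
Proof.
move=> [ll rl]; rewrite memv_cap memvf; apply/centvP => a _.
(* As $S$ is surjective, commuting with every [S a] suffices. *)
rewrite -[a]antipodeVK; move: (S^-1 a) => {}a.
set t := qR Q * Delta l * pR Q.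
have tl : (1 \ox a) * t = (S a \ox 1) * t.
  by rewrite /t (qR_eq_qL ll) mulrA qL_left_integral // !mulrA.
have tr : t * (a \ox 1) = t * (1 \ox S a).
  by rewrite /t -!(mulrA (qR Q)) pR_right_integral.
have := mult_inner a t; rewrite tl tr => E.
have := mult_outer (S a) 1 t; have := mult_outer 1 (S a) t.
by rewrite tpure1 mulr1 !mul1r E => -> ->; rewrite mulr1.
Qed.

End Contractions.

Theorem theorem3p3 (k : fieldType) (H : falgType k) (Q : qhopf_data H)
    (hQ : is_quasi_hopf Q) (l : H) (hl : two_sided_integral Q l) :
  (forall (F : gauge Q) (A B : side),
     qel A (twist F) * qh_Delta (twist F) l * pel B (twist F)
     = qel A Q * qh_Delta Q l * pel B Q)
  /\ [/\ mult (qR Q * qh_Delta Q l * pR Q) = mult (qR Q * qh_Delta Q l * pL Q),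
         mult (qR Q * qh_Delta Q l * pL Q) = mult (qL Q * qh_Delta Q l * pR Q),
         mult (qL Q * qh_Delta Q l * pR Q) = mult (qL Q * qh_Delta Q l * pL Q)
       & mult (qR Q * qh_Delta Q l * pR Q) \in 'Z({:H})%VS].
Proof.
have [ll rl] := hl; split=> [F A B|]; first exact: twist_invariant.
have qE := qR_eq_qL hQ ll; have pE := pR_eq_pL hQ rl.
split; last exact: mult_central.
- by rewrite -!mulrA pE.
- by rewrite -qE -!mulrA pE.
- by rewrite -!mulrA pE.
Qed.
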